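(* Let $A$ be a (not necessarily bounded) hyponormal operator with domain $D(A)\subset H$, where $H$ is a complex Hilbert space. If $A^p$ and $A^q$ are both self-adjoint, where $p$ and $q$ are two co-prime positive integers, then $A$ is self-adjoint.
   Context: Operators are linear and not necessarily bounded. Powers are defined on natural domains, with $D(ST)=\{x\in D(T):Tx\in D(S)\}$. A densely defined operator $A$ is hyponormal if $D(A)\subset D(A^* )$ and $\|A^*x\|\leq\|Ax\|$ for all $x\in D(A)$ (closedness is not assumed). A densely defined operator $S$ is self-adjoint if $S=S^*$. *)

(* Defs.v *)
From mathcomp Require Import all_boot all_order all_algebra.
From mathcomp Require Import sesquilinear complex.
From mathcomp Require Import all_classical all_reals all_analysis.
Import Order.TTheory GRing.Theory Num.Theory.
Import numFieldNormedType.Exports.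

Set Implicit Arguments.
Unset Strict Implicit.
Unset Printing Implicit Defensive.

Local Open Scope classical_set_scope.
Local Open Scope ring_scope.

(* A partially defined map on H. The values of [opfun A] outside [dom A] are
   junk, which [op_eq] and the predicates below ignore. *)
Record operator (H : Type) := Operator { dom : set H; opfun :> H -> H }.

(* Equality of operators, S = T: same domain, and same values on it. *)
Definition op_eq (H : Type) (S T : operator H) : Prop :=
  dom S = dom T /\ forall x, dom S x -> S x = T x.

Definition op_id (H : Type) : operator H := Operator setT id.

Definition op_comp (H : Type) (S T : operator H) : operator H :=
  Operator [set x | dom T x /\ dom S (T x)] (S \o T).

Fixpoint op_pow (H : Type) (A : operator H) (n : nat) : operator H :=
  if n is m.+1 then op_comp A (op_pow A m) else op_id H.

Definition linear_operator (K : numFieldType) (H : lmodType K)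
    (A : operator H) : Prop :=
  dom A 0 /\
  forall (a : K) (x y : H), dom A x -> dom A y ->
    dom A (a *: x + y) /\ A (a *: x + y) = a *: A x + A y.

Section Hilbert.
Variables (R : realType) (H : completeNormedModType R[i]).

(* With the completeness carried by the type of H, this says that H is a
   complex Hilbert space. The form [ip] is linear in its first argument and
   conjugate-linear in the second. *)
Definition induces_norm (ip : {dot H for Num.conj}) : Prop :=
  forall x : H, `|x| ^+ 2 = ip x x.

Variable ip : {dot H for Num.conj}.

Definition densely_defined (A : operator H) : Prop := dense (dom A).

(* z is a value of the adjoint of A at y; it is unique when A is densely
   defined. *)
Definition adjoint_value (A : operator H) (y z : H) : Prop :=
  forall x, dom A x -> ip (A x) y = ip x z.

(* Meaningful only for densely defined A. *)
Definition adjoint (A : operator H) : operator H :=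
  Operator [set y | exists z, adjoint_value A y z]
           (fun y => xget 0 [set z | adjoint_value A y z]).

Definition self_adjoint (S : operator H) : Prop :=
  densely_defined S /\ op_eq S (adjoint S).

Definition hyponormal (A : operator H) : Prop :=
  [/\ densely_defined A,
      dom A `<=` dom (adjoint A)
    & forall x, dom A x -> `|adjoint A x| <= `|A x|].

End Hilbert.

(* Main.v *)
Require Import Defs.
From mathcomp Require Import all_boot all_order all_algebra.
From mathcomp Require Import sesquilinear complex.
From mathcomp Require Import all_classical all_reals all_analysis.
From mathcomp Require Import ring.
Import Order.TTheory GRing.Theory Num.Theory.
Import numFieldNormedType.Exports.

(* By Bezout, m p = n q + 1, so B = A^(n q) and A B are symmetric. Hence, for
   y in dom (A B), the vector d = A^* y - A y is orthogonal to B (dom (A B)).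
   As A^q is self-adjoint, this gives A^q d = 0, and hyponormality yields
   A d = 0 and then A^* d = 0, so that |d|^2 = <d, A^* y> - <d, A y> = 0. Thus
   A^* = A on dom (A B), which is dense, and so A is symmetric.
   Finally A commutes with the resolvents of A^q, which map into dom A; for y
   in dom A^*, applying one to y shows that y is in dom A. *)

Set Implicit Arguments.
Unset Strict Implicit.
Unset Printing Implicit Defensive.

Local Open Scope classical_set_scope.
Local Open Scope ring_scope.

(** A positive element of [R[i]] is real, so the Archimedean property of [R] applies to it. *)
Lemma complex_natSinv_lt {R : realType} (e : R[i]) :
  0 < e -> \forall n \near \oo, n.+1%:R^-1 < e.
Proof.
move=> e0; have /complex_realP[r er] := gtr0_real e0.
move: e0; rewrite er ltcR => r0.
near=> n.
have : n.+1%:R^-1 < r by near: n; exact: (near_infty_natSinv_lt (PosNum r0)).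
by rewrite -ltcR fmorphV/= rmorph_nat.
Unshelve. all: by end_near. Qed.

(** * Powers on natural domains *)

Section Powers.
Variables (T : Type) (A : operator T).

Lemma op_powD m n x : op_pow A (m + n) x = op_pow A m (op_pow A n x).
Proof. by elim: m => //= m IHm; rewrite IHm. Qed.

Lemma dom_op_powD m n x : dom (op_pow A (m + n)) x <->
  dom (op_pow A n) x /\ dom (op_pow A m) (op_pow A n x).
Proof.
elim: m => [|m IHm] /=; first by split=> [//|[]].
by rewrite op_powD; split=> [[/IHm[]]|[? []]] //; split=> //; apply/IHm.
Qed.

Lemma dom_op_pow_le m n x : (m <= n)%N ->
  dom (op_pow A n) x -> dom (op_pow A m) x.
Proof. by move=> mn; rewrite -(subnK mn) => /dom_op_powD[]. Qed.

Lemma dom_of_dom_op_pow n x : (0 < n)%N -> dom (op_pow A n) x -> dom A x.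
Proof. by move=> n0 /(dom_op_pow_le n0)[]. Qed.

End Powers.

(** * Linearity on domains *)

Section LinearOperators.
Context {K : numFieldType} {H : lmodType K}.
Implicit Types (A : operator H).

Lemma domP A a x y :
  linear_operator A -> dom A x -> dom A y -> dom A (a *: x + y).
Proof. by move=> [_ linA] Dx Dy; have [] := linA a x y Dx Dy. Qed.

Lemma opP A a x y : linear_operator A -> dom A x -> dom A y ->
  A (a *: x + y) = a *: A x + A y.
Proof. by move=> [_ linA] Dx Dy; have [] := linA a x y Dx Dy. Qed.

Lemma domB A x y :
  linear_operator A -> dom A x -> dom A y -> dom A (x - y).
Proof. by move=> linA Dx Dy; rewrite addrC -scaleN1r; apply: domP. Qed.

Lemma opB A x y : linear_operator A -> dom A x -> dom A y ->
  A (x - y) = A x - A y.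
Proof.
by move=> linA Dx Dy; rewrite addrC -scaleN1r opP// scaleN1r addrC.
Qed.

Lemma op0 A : linear_operator A -> A 0 = 0.
Proof.
by move=> linA; rewrite -[X in A X](subrr (0 : H)) opB ?subrr; case: linA.
Qed.

Lemma domZ A a x :
  linear_operator A -> dom A x -> dom A (a *: x).
Proof.
by move=> linA Dx; rewrite -[_ *: _]addr0; apply: domP => //; case: linA.
Qed.

Lemma opZ A a x : linear_operator A -> dom A x ->
  A (a *: x) = a *: A x.
Proof.
move=> linA Dx; rewrite -[X in A X]addr0 opP//; last by case: linA.
by rewrite op0// addr0.
Qed.

Lemma linear_op_pow A n : linear_operator A -> linear_operator (op_pow A n).
Proof.
move=> linA; have [A0 _] := linA.
elim: n => [|n IHn] //=; split => [|a x y [Dx DAx] [Dy DAy]] /=.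
  by rewrite op0//; split => //; case: IHn.
by rewrite opP// opP//; split=> //; split; [apply: domP|apply: domP].
Qed.

End LinearOperators.

(** * Inner product geometry and orthogonal projection *)

Section Hilbert.
Context {R : realType} {H : completeNormedModType R[i]}.
Variable ip : {dot H for Num.conj}.
Hypothesis ip_norm : induces_norm ip.

Lemma ipC x y : ip x y = (ip y x)^*.
Proof. by rewrite hermC expr0 mul1r. Qed.

Lemma ipZr a x y : ip x (a *: y) = a^* * ip x y.
Proof. by rewrite linearZr_LR. Qed.

Lemma ipZl a x y : ip (a *: x) y = a * ip x y.
Proof. by rewrite linearZl_LR. Qed.

Lemma ip_eq0 x : ip x x = 0 -> x = 0.
Proof. by move/eqP; rewrite dnorm_eq0 => /eqP. Qed.

(* delta = 0 is Cauchy-Schwarz; with delta the squared distance of g to a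
   subspace containing v, it bounds how far g is from being orthogonal to v. *)
Lemma ip_quadratic_bound (delta : R[i]) (g v : H) :
  (forall t, delta <= ip (g - t *: v) (g - t *: v)) ->
  `|ip g v| ^+ 2 <= (ip g g - delta) * ip v v.
Proof.
move=> min; have [->|v0] := eqVneq v 0.
  by rewrite !linear0r normr0 expr0n.
have vv0 : 0 < ip v v by rewrite dnorm_gt0.
have vvJ : (ip v v)^* = ip v v by rewrite -ipC.
(* This [t] minimises the quadratic: it projects [g] onto the line of [v]. *)
have := min (ip g v / ip v v).
have -> : ip (g - (ip g v / ip v v) *: v) (g - (ip g v / ip v v) *: v) =
    ip g g - `|ip g v| ^+ 2 / ip v v.
  rewrite dnormB dnormZ ipZr !(rmorphM, fmorphV)/= conjCK vvJ.
  rewrite vvJ normrM normfV (gtr0_norm vv0) expr_div_n normCK.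
  by field; rewrite gt_eqF.
by rewrite lerBrDr addrC -lerBrDr ler_pdivrMr.
Qed.

Lemma ip_CauchySchwarz x y : `|ip x y| <= `|x| * `|y|.
Proof.
rewrite -(ler_pXn2r (n:=2)) ?nnegrE ?mulr_ge0// exprMn !ip_norm.
have := @ip_quadratic_bound 0 x y; rewrite subr0; apply=> t; exact: dnorm_ge0.
Qed.

Lemma ip_cvgl {T : Type} {F : set_system T} {FF : Filter F} (u : T -> H) l y :
  u @ F --> l -> (fun n => ip (u n) y) @ F --> ip l y.
Proof.
move=> ul; apply/cvgrPdist_lt => e e0.
have y0 : 0 < `|y| + 1 by rewrite ltr_wpDl.
near=> n; rewrite -linearBl; apply: le_lt_trans (ip_CauchySchwarz _ _) _.
apply: (@le_lt_trans _ _ (`|l - u n| * (`|y| + 1))).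
  by rewrite ler_wpM2l// lerDl.
rewrite -ltr_pdivlMr//; near: n.
by move/cvgrPdist_lt : ul; apply; rewrite divr_gt0.
Unshelve. all: by end_near. Qed.

Lemma dense_orthogonal (D : set H) u :
  dense D -> (forall x, D x -> ip x u = 0) -> u = 0.
Proof.
move=> Ddense Du; apply/eqP/negPn/negP => u0.
have u_gt0 : 0 < `|u| by rewrite normr_gt0.
(* A point x of D in this ball would give |u|^2 = <u - x, u> <= |u - x| |u| < |u|^2. *)
have [||x [ux Dx]] := Ddense (ball u `|u|).
- by exists u; exact: ballxx.
- exact: ball_open.
have := ip_CauchySchwarz (u - x) u; rewrite linearBl/= (Du x)// subr0 -ip_norm.
rewrite normrX normr_id expr2 ler_pM2r// => u_le.
by move: ux; rewrite -ball_normE /= => /(le_lt_trans u_le); rewrite ltxx.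
Qed.

(** The order of [R[i]] is partial, so the infimum is taken in [R], over the real parts of the
    squared distances, which are real anyway. *)
Lemma dist_infimum (M : set H) (f : H) : M !=set0 ->
  exists2 delta : R[i],
    forall m, M m -> delta <= ip (f - m) (f - m)
  & forall n : nat, exists m, M m /\ ip (f - m) (f - m) < delta + n.+1%:R^-1.
Proof.
move=> [m0 Mm0].
pose E := [set complex.Re (ip (f - m) (f - m)) | m in M].
have ReE x : ip x x = real_complex R (complex.Re (ip x x)).
  by rewrite RRe_real// ger0_real// dnorm_ge0.
have Elb : lbound E 0.
  by move=> _ [m Mm <-]; rewrite -lecR -ReE dnorm_ge0.
have infE : has_inf E.
  by split; [exists (complex.Re (ip (f - m0) (f - m0))), m0|exists 0].
exists (real_complex R (inf E)).
  by move=> m Mm; rewrite ReE lecR; apply: ge_inf; [exists 0|exists m].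
move=> n; have n0 : (0 : R) < n.+1%:R^-1 by rewrite invr_gt0.
have [_ [m Mm <-] mlt] := inf_adherent n0 infE.
exists m; split=> //; rewrite ReE; move: mlt.
by rewrite -ltcR rmorphD/= fmorphV/= rmorph_nat.
Qed.

Lemma parallelogram x y :
  ip (x - y) (x - y) + ip (x + y) (x + y) = 2 * ip x x + 2 * ip y y.
Proof. by rewrite dnormB dnormD; ring. Qed.

Lemma norm_lt (e : R[i]) x : 0 < e -> ip x x < e ^+ 2 -> `|x| < e.
Proof.
by move=> e0; rewrite -ip_norm ltr_pXn2r// ?nnegrE ?(ltW e0).
Qed.

(** The subspace M need not be closed, so l may lie outside it; the minimising sequence is therefore
    returned as well. *)
Lemma orthogonal_projection (M : set H) (f : H) : M 0 ->
  (forall (a : R[i]) x y, M x -> M y -> M (a *: x + y)) ->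
  exists2 m_ : nat -> H, forall n, M (m_ n)
  & exists2 l, m_ @ \oo --> l & forall v, M v -> ip (f - l) v = 0.
Proof.
move=> M0 Mlin.
have Mn0 : M !=set0 by exists 0.
have [delta lb /choice[m_ mlt]] := dist_infimum f Mn0.
have Mm n : M (m_ n) by case: (mlt n).
have {}mlt n : ip (f - m_ n) (f - m_ n) - delta < n.+1%:R^-1.
  by rewrite ltrBlDl; case: (mlt n).
exists m_ => //.
have dist_lt k n :
    ip (m_ k - m_ n) (m_ k - m_ n) < 2 * k.+1%:R^-1 + 2 * n.+1%:R^-1.
  have := parallelogram (f - m_ n) (f - m_ k).
  have -> : f - m_ n - (f - m_ k) = m_ k - m_ n.
    by rewrite opprB addrC addrA subrK.
  have -> : f - m_ n + (f - m_ k) = 2 *: (f - (2^-1 *: m_ n + 2^-1 *: m_ k)).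
    rewrite scalerBr scalerDr !scalerA mulfV ?pnatr_eq0// !scale1r scaler_nat.
    by rewrite opprD addrACA mulr2n.
  (* The midpoint lies in M, so the sum term of the parallelogram law is at least 4 [delta]; this
     makes the difference term small. *)
  have mid : delta <= ip (f - (2^-1 *: m_ n + 2^-1 *: m_ k))
                         (f - (2^-1 *: m_ n + 2^-1 *: m_ k)).
    by apply: lb; apply: (Mlin) => //; rewrite -[_ *: _]addr0; apply: Mlin.
  rewrite dnormZ normr_nat => /(canRL (addrK _)) ->.
  move: (ip (f - _) _) (ip (f - m_ n) _) (ip (f - m_ k) _) mid (mlt n) (mlt k).
  move=> y g h; rewrite -subr_ge0 => y0.
  do 2 rewrite -(subr_gt0 (_ - delta)) => ?.
  rewrite -subr_gt0.
  have -> : 2 / k.+1%:R + 2 / n.+1%:R - (2 * g + 2 * h - 2 ^+ 2 * y) =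
      2 * (n.+1%:R^-1 - (g - delta)) + 2 * (k.+1%:R^-1 - (h - delta)) +
      2 ^+ 2 * (y - delta) by ring.
  by rewrite ltr_wpDr ?addr_gt0 ?mulr_gt0 ?mulr_ge0.
have : cvg (m_ @ \oo).
  apply: cauchy_cvg; apply: cauchy_exP => e e0.
  have e2 : 0 < e ^+ 2 / 4 by rewrite divr_gt0// exprn_gt0.
  have [N _ Ne] := complex_natSinv_lt e2.
  exists (m_ N); exists N => // n /= Nn.
  rewrite -ball_normE /=; apply: norm_lt => //.
  apply: lt_trans (dist_lt _ _) _.
  rewrite (_ : e ^+ 2 = 2 * (e ^+ 2 / 4) + 2 * (e ^+ 2 / 4)); last by field.
  by apply: ltrD; rewrite ltr_pM2l//; apply: Ne; rewrite /=.
move=> /cvg_ex[l ml]; exists l => // v Mv.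
(* By the quadratic bound, |<f - m_n, v>|^2 is at most |v|^2 / (n + 1). *)
have cvg0 : (fun n => ip (f - m_ n) v) @ \oo --> (0 : (R[i] : numFieldType)).
  apply/cvgrPdist_lt => e e0.
  have v0 : 0 < ip v v + 1 by rewrite ltr_wpDl// dnorm_ge0.
  have e2 : 0 < e ^+ 2 / (ip v v + 1) by rewrite divr_gt0// exprn_gt0.
  near=> n; rewrite sub0r normrN -(ltr_pXn2r (n:=2)) ?nnegrE ?(ltW e0)//.
  have bound :
      `|ip (f - m_ n) v| ^+ 2 <= (ip (f - m_ n) (f - m_ n) - delta) * ip v v.
    apply: ip_quadratic_bound => t.
    rewrite -addrA -opprD; apply: lb.
    by rewrite addrC; apply: Mlin.
  apply: le_lt_trans bound _.
  apply: (@le_lt_trans _ _ (n.+1%:R^-1 * (ip v v + 1))).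
    by apply: ler_pM; rewrite ?subr_ge0 ?dnorm_ge0 ?lerDl ?lb ?(ltW (mlt _)).
  by rewrite -ltr_pdivlMr//; near: n; exact: complex_natSinv_lt.
have cvgl : (fun n => ip (f - m_ n) v) @ \oo --> ip (f - l) v.
  by apply: ip_cvgl => //; apply: cvgB => //; exact: cvg_cst.
exact: (cvg_unique _ cvgl cvg0).
Unshelve. all: by end_near. Qed.

(** * Self-adjoint operators and their resolvents *)

Definition symmetric_on (A : operator H) :=
  forall x y, dom A x -> dom A y -> ip (A x) y = ip x (A y).

Lemma adjoint_spec (A : operator H) y :
  dom (adjoint ip A) y -> adjoint_value ip A y (adjoint ip A y).
Proof. exact: xgetPex. Qed.

Lemma self_adjoint_symmetric T : self_adjoint ip T -> symmetric_on T.
Proof.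
move=> [_ [domE TE]] x y Dx Dy; rewrite (TE y Dy); apply: adjoint_spec Dx.
by rewrite -domE.
Qed.

Lemma self_adjoint_value T y z : self_adjoint ip T ->
  adjoint_value ip T y z -> dom T y /\ T y = z.
Proof.
move=> saT Tyz; have [Tdense [domE TE]] := saT.
have Dy : dom T y by rewrite domE; exists z.
split=> //; apply/eqP; rewrite -subr_eq0; apply/eqP.
apply: (dense_orthogonal Tdense) => x Dx.
by rewrite linearBr/= -(self_adjoint_symmetric saT) -?Tyz// subrr.
Qed.

(** For purely imaginary c, T - c is bounded below. Project f onto its range: the preimages of the
    minimising sequence converge because of the lower bound, and the remainder vanishes because T
    has no non-real eigenvalue. *)
Lemma self_adjoint_resolvent (T : operator H) (c : R[i]) f :
  linear_operator T -> self_adjoint ip T -> c^* = - c -> c != 0 ->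
  exists2 w, dom T w & T w - c *: w = f.
Proof.
move=> linT saT cJ c0; have Tsym := self_adjoint_symmetric saT.
have [T0 Tlin] := linT.
pose M := [set g | exists w, dom T w /\ T w - c *: w = g].
have M0 : M 0 by exists 0; rewrite op0// scaler0 subrr.
have Mlin (a : R[i]) x y : M x -> M y -> M (a *: x + y).
  move=> [w [Dw <-]] [w' [Dw' <-]]; have [Dw'' E] := Tlin a _ _ Dw Dw'.
  exists (a *: w + w'); split=> //; rewrite E !scalerDr scalerN !scalerA mulrC.
  by rewrite opprD addrACA.
have [m_ /choice[w_ wE] [l ml lM]] := orthogonal_projection f M0 Mlin.
have Dw n : dom T (w_ n) by case: (wE n).
have {wE} Ew n : T (w_ n) - c *: w_ n = m_ n by case: (wE n).
(* The cross terms cancel, so |T x - c x|^2 = |T x|^2 + |c|^2 |x|^2. *)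
have coercive x : dom T x -> `|c| * `|x| <= `|T x - c *: x|.
  move=> Dx; rewrite -(ler_pXn2r (n:=2)) ?nnegrE ?mulr_ge0// exprMn !ip_norm.
  rewrite dnormB dnormZ ipZr cJ rmorphM/= -ipC rmorphN/= cJ opprK.
  by rewrite -(Tsym _ _ Dx Dx) mulNr addNr subr0 lerDr dnorm_ge0.
have : cvg (w_ @ \oo).
  apply: cauchy_cvg; apply: cauchy_exP => e e0.
  have e2 : 0 < `|c| * e / 2 by rewrite divr_gt0// mulr_gt0// normr_gt0.
  have /cvgrPdist_lt/(_ _ e2)[N _ Ne] := ml.
  exists (w_ N); exists N => // n /= Nn; rewrite -ball_normE /=.
  rewrite -(ltr_pM2l (x := `|c|)) ?normr_gt0//.
  apply: le_lt_trans (coercive _ (domB _ _ _)) _ => //.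
  have -> : T (w_ N - w_ n) - c *: (w_ N - w_ n) = (l - m_ n) - (l - m_ N).
    rewrite opB// scalerBr opprD addrACA -opprD !Ew.
    by rewrite opprB [RHS]addrC addrA subrK.
  apply: le_lt_trans (ler_normB _ _) _.
  by rewrite [X in _ < X]splitr ltrD// Ne /=.
move=> /cvg_ex[w ww].
have Tww : (T \o w_) @ \oo --> l + c *: w.
  rewrite (_ : T \o w_ = m_ \+ (fun n => c *: w_ n)); last first.
    by apply/funext => n /=; rewrite -Ew subrK.
  by apply: cvgD => //; apply: cvgZr.
(* T is closed, being its own adjoint: pass to the limit in <w_n, T x> = <T w_n, x>. *)
have [Dw' Tw] : dom T w /\ T w = l + c *: w.
  apply: self_adjoint_value saT _ => x Dx.
  rewrite [LHS]ipC [RHS]ipC; congr (_^*).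
  have cvg1 : (fun n => ip (w_ n) (T x)) @ \oo --> ip w (T x) by exact: ip_cvgl.
  have cvg2 : (fun n => ip (w_ n) (T x)) @ \oo --> ip (l + c *: w) x.
    rewrite (_ : (fun n => _) = fun n => ip ((T \o w_) n) x); last first.
      by apply/funext => n /=; rewrite Tsym.
    exact: ip_cvgl.
  exact: (cvg_unique _ cvg1 cvg2).
exists w => //; rewrite Tw addrK.
apply/eqP; rewrite eq_sym -subr_eq0; apply/eqP.
(* r is orthogonal to the range of T - c, hence an eigenvector of T for the
   non-real eigenvalue -c. *)
set r := f - l in lM *.
have [Dr Tr] : dom T r /\ T r = - c *: r.
  apply: self_adjoint_value saT _ => x Dx.
  have : ip (T x - c *: x) r = 0.
    by rewrite ipC lM ?conjC0//; exists x.
  rewrite linearBl/= ipZl => /eqP; rewrite subr_eq0 => /eqP->.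
  by rewrite ipZr rmorphN/= cJ opprK.
have := Tsym _ _ Dr Dr; rewrite Tr ipZl ipZr rmorphN/= cJ opprK => /eqP.
rewrite -subr_eq0 -mulrBl mulf_eq0 -opprD oppr_eq0 -mulr2n mulrn_eq0 (negPf c0).
by move/eqP/ip_eq0.
Qed.

(** * Powers of A when A^q is self-adjoint *)

Variable A : operator H.
Hypothesis linA : linear_operator A.

Let linAn n : linear_operator (op_pow A n) := linear_op_pow n linA.
Local Hint Resolve linAn : core.

Lemma symmetric_op_powM q n :
  symmetric_on (op_pow A q) -> symmetric_on (op_pow A (n * q)).
Proof.
move=> symq; elim: n => [|n IHn] x y //; rewrite mulSn.
move=> /dom_op_powD[Dx DAx]; rewrite addnC => /dom_op_powD[Dy DAy].
by rewrite -[in LHS]addnC !op_powD symq// IHn.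
Qed.

Variable q : nat.
Hypothesis q_gt0 : (0 < q)%N.
Hypothesis saQ : self_adjoint ip (op_pow A q).

(** Bootstrapping: if f = A^q w - c w, then A^q w = f + c w is as regular as the worse of f and w,
    and q > 0 gains at least one power at each step. *)
Lemma dom_op_powD_resolvent (c : R[i]) j w : dom (op_pow A q) w ->
  dom (op_pow A j) (op_pow A q w - c *: w) -> dom (op_pow A (j + q)) w.
Proof.
move=> Dw; elim: j => [//|j IHj] Df.
have Djw : dom (op_pow A (j + q)) w by apply: IHj; apply: dom_op_pow_le Df.
apply/dom_op_powD; split=> //.
rewrite -[op_pow A q w](subrK (c *: w)) -[X in X + _]scale1r.
apply: domP => //; apply: domZ => //; apply: dom_op_pow_le Djw.
by rewrite -addn1 leq_add2l.
Qed.

Lemma op_pow_resolvent (c : R[i]) j f : c^* = - c -> c != 0 ->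
  dom (op_pow A j) f ->
  exists2 w, dom (op_pow A (j + q)) w & op_pow A q w - c *: w = f.
Proof.
move=> cJ c0 Df.
have [w Dw wf] := self_adjoint_resolvent f (linAn q) saQ cJ c0.
by exists w => //; apply: (dom_op_powD_resolvent (c := c)) => //; rewrite wf.
Qed.

Lemma ip_resolvent (c : R[i]) x y : c^* = - c ->
  dom (op_pow A q) x -> dom (op_pow A q) y ->
  ip (op_pow A q x - c *: x) y = ip x (op_pow A q y + c *: y).
Proof.
move=> cJ Dx Dy; rewrite linearBl/= linearDr/= ipZl ipZr cJ mulNr.
by rewrite (self_adjoint_symmetric saQ).
Qed.

(** The resolvents at c and -c are adjoint to each other. Replacing u by v smooths it into dom A^q
    while keeping track of its inner products. *)
Lemma ip_resolvent_preimage (c : R[i]) u : c^* = - c -> c != 0 ->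
  exists2 v, dom (op_pow A q) v & op_pow A q v + c *: v = u /\
    forall x, dom (op_pow A q) x -> ip (op_pow A q x - c *: x) v = ip x u.
Proof.
move=> cJ c0; have cNJ : (- c)^* = - - c by rewrite rmorphN/= cJ.
have cN0 : - c != 0 by rewrite oppr_eq0.
have [v Dv vu] := @op_pow_resolvent (- c) 0 u cNJ cN0 I.
rewrite scaleNr opprK in vu.
by exists v => //; split=> // x Dx; rewrite ip_resolvent// vu.
Qed.

(** A weak form of the density of dom A^j. If f is in dom A^j, its preimage x under A^q - i is in
    dom A^(j+1), so <f, v> = <x, u> = 0 for v = (A^q + i)^-1 u. *)
Lemma dom_op_pow_orthogonal j u :
  (forall x, dom (op_pow A j) x -> ip x u = 0) -> u = 0.
Proof.
elim: j u => [|j IHj] u uD; first by apply: ip_eq0 (uD u _).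
have [v Dv [vu uv]] := ip_resolvent_preimage u (conjCi _) (neq0Ci _).
have v0 : v = 0.
  apply: IHj => f Df.
  have [x Dx <-] := op_pow_resolvent (conjCi _) (neq0Ci _) Df.
  have /dom_op_powD[Dqx _] := Dx.
  by rewrite uv// uD//; apply: dom_op_pow_le Dx; rewrite -addn1 leq_add2l.
by rewrite -vu v0 op0// scaler0 addr0.
Qed.

(** Formally A^(n q) d = 0, and a self-adjoint operator has the same kernel as its powers. Since d
    is not known to be in any domain, the argument is run on e = (A^q + i)^-1 d, and the induction
    applies to A^q e with the same M. *)
Lemma orthogonal_op_pow_range n M d : (n * q <= M)%N ->
  (forall x, dom (op_pow A M) x -> ip (op_pow A (n * q) x) d = 0) ->
  dom (op_pow A q) d /\ op_pow A q d = 0.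
Proof.
elim: n d => [|n IHn] d nM dM.
  rewrite (dom_op_pow_orthogonal dM) op0//; split=> //.
  by case: (linAn q).
rewrite mulSn in nM dM.
have [e De [ed ud]] := ip_resolvent_preimage d (conjCi _) (neq0Ci _).
have [DQe QQe] :
    dom (op_pow A q) (op_pow A q e) /\ op_pow A q (op_pow A q e) = 0.
  apply: IHn => [|x Dx]; first by apply: leq_trans nM; rewrite leq_addl.
  have /dom_op_powD[Dnx Dqnx] := dom_op_pow_le nM Dx.
  rewrite -(self_adjoint_symmetric saQ)// -op_powD.
  (* With x = (A^q - i) s, <A^(q + n q) x, e> = <A^(q + n q) s, d> = 0. *)
  have [s Ds sx] := op_pow_resolvent (conjCi _) (neq0Ci _) Dx.
  have DMs : dom (op_pow A M) s by apply: dom_op_pow_le Ds; rewrite leq_addr.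
  have Dks := dom_op_pow_le nM DMs.
  have /dom_op_powD[Dqs DMqs] := Ds.
  have Dkqs := dom_op_pow_le nM DMqs.
  rewrite -sx opB//; last exact: domZ.
  rewrite opZ// -op_powD [in X in X - _]addnC op_powD ud ?dM//.
  have : dom (op_pow A (q + (q + n * q))) s.
    by rewrite addnC; apply/dom_op_powD.
  by case/dom_op_powD.
(* |A^q e|^2 = <e, A^q A^q e> = 0, hence d = i e. *)
have Qe0 : op_pow A q e = 0.
  by apply: ip_eq0; rewrite (self_adjoint_symmetric saQ)// QQe linear0r.
rewrite Qe0 add0r in ed.
by rewrite -ed opZ// Qe0 scaler0; split=> //; apply: domZ.
Qed.

End Hilbert.

(** * Hyponormal operators with self-adjoint powers *)

Section Hyponormal.
Context {R : realType} {H : completeNormedModType R[i]}.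
Variable ip : {dot H for Num.conj}.
Hypothesis ip_norm : induces_norm ip.
Variable A : operator H.
Hypothesis linA : linear_operator A.
Hypothesis hypA : hyponormal ip A.

Lemma hyponormal_adjoint_value x : dom A x ->
  adjoint_value ip A x (adjoint ip A x).
Proof. by have [_ sub _] := hypA => /sub; exact: adjoint_spec. Qed.

Lemma hyponormal_adjoint_eq0 x : dom A x -> A x = 0 -> adjoint ip A x = 0.
Proof.
move=> Dx Ax0; have [_ _ /(_ _ Dx)] := hypA.
by rewrite Ax0 normr0 normr_le0 => /eqP.
Qed.

(** Since ker A is contained in ker A^*, A A u = 0 gives |A u|^2 = <u, A^* A u> = 0; this removes
    one power at a time. *)
Lemma hyponormal_op_pow_eq0 n x : (0 < n)%N ->
  dom (op_pow A n) x -> op_pow A n x = 0 -> A x = 0.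
Proof.
elim: n => [//|[|n] IHn] _ //= [[Dn DAn] DAAn] A0.
apply: IHn => //=; apply: (@ip_eq0 _ _ ip).
by rewrite (hyponormal_adjoint_value DAAn)// hyponormal_adjoint_eq0// linear0r.
Qed.

Lemma adjoint_eq_of_defect_ker y : dom A y ->
  dom A (adjoint ip A y - A y) -> A (adjoint ip A y - A y) = 0 ->
  adjoint ip A y = A y.
Proof.
set d := adjoint ip A y - A y => Dy Dd Ad0.
apply/eqP; rewrite -subr_eq0 -/d; apply/eqP; apply: (@ip_eq0 _ _ ip).
rewrite {2}/d linearBr/= -(hyponormal_adjoint_value Dy)// Ad0 linear0l sub0r.
rewrite ipC (hyponormal_adjoint_value Dd)// hyponormal_adjoint_eq0//.
by rewrite linear0r conjC0 oppr0.
Qed.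

Variables p q : nat.
Hypothesis q_gt0 : (0 < q)%N.
Hypothesis saP : self_adjoint ip (op_pow A p).
Hypothesis saQ : self_adjoint ip (op_pow A q).

Lemma coprime_powers_adjoint_eq_on m n y : (m * p = (n * q).+1)%N ->
  dom (op_pow A (n * q).+1) y -> adjoint ip A y = A y.
Proof.
move=> mn DSy.
have Dy : dom A y by exact: (dom_of_dom_op_pow _ DSy).
have := DSy; rewrite -addn1 => /dom_op_powD[_ DnAy].
have symQn := symmetric_op_powM (n := n) (self_adjoint_symmetric saQ).
have symPm := symmetric_op_powM (n := m) (self_adjoint_symmetric saP).
(* With B = A^(n q), both <B x, A^* y> = <A B x, y> and <B x, A y> = <x, B A y> are values of the
   symmetric form of A^(m p). *)
have defect x : dom (op_pow A (n * q).+1) x ->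
    ip (op_pow A (n * q) x) (adjoint ip A y - A y) = 0.
  move=> DSx; have [Dnx DAnx] := DSx.
  rewrite linearBr/= -(hyponormal_adjoint_value Dy)// symQn//.
  rewrite -[A (op_pow A _ x)]/(op_pow A (n * q).+1 x).
  rewrite -[A y]/(op_pow A 1 y) -op_powD addn1.
  by rewrite -mn symPm ?mn// subrr.
have [Dqd Aqd] :=
  orthogonal_op_pow_range ip_norm linA q_gt0 saQ (leqnSn _) defect.
apply: adjoint_eq_of_defect_ker => //.
  exact: (dom_of_dom_op_pow _ Dqd).
exact: hyponormal_op_pow_eq0 Aqd.
Qed.

(** Test A^* x - A x against v in dom A^(n q + 1), where A^* v = A v is known: <A v, x> = <A^* v, x>
    = <v, A x>. *)
Lemma coprime_powers_adjoint_eq m n x : (m * p = (n * q).+1)%N -> dom A x ->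
  adjoint ip A x = A x.
Proof.
move=> mn Dx; apply/eqP; rewrite -subr_eq0; apply/eqP.
apply: (dom_op_pow_orthogonal ip_norm linA q_gt0 saQ (j := (n * q).+1)) => v Dv.
have DAv : dom A v by exact: (dom_of_dom_op_pow _ Dv).
rewrite linearBr/= -(hyponormal_adjoint_value Dx)//.
rewrite -(coprime_powers_adjoint_eq_on mn Dv) [X in X - _]ipC.
by rewrite -(hyponormal_adjoint_value DAv)// -ipC subrr.
Qed.

(** Let z = A^* y, and let w, w' be the images of y, z under (A^q + i)^-1. Then A w = w' is in dom
    A^q, so w is in dom A^(q+1) and y = A^q w + i w is in dom A. *)
Lemma dom_adjoint_sub : symmetric_on ip A -> dom (adjoint ip A) `<=` dom A.
Proof.
move=> symA y [z yz].
have [w Dw [wy yw]] :=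
  ip_resolvent_preimage ip_norm linA q_gt0 saQ y (conjCi _) (neq0Ci _).
have [w' Dw' [_ zw']] :=
  ip_resolvent_preimage ip_norm linA q_gt0 saQ z (conjCi _) (neq0Ci _).
have D1 v : dom (op_pow A q) v -> dom A v by exact: dom_of_dom_op_pow.
have Dq1 s : dom (op_pow A (1 + q)) s ->
    [/\ dom A (op_pow A q s), dom (op_pow A q) (A s)
      & A (op_pow A q s) = op_pow A q (A s)].
  move=> Ds; have /dom_op_powD[_ [_ D1s]] := Ds.
  have := Ds; rewrite addnC => /dom_op_powD[_ DqAs]; split=> //.
  by rewrite -[LHS](op_powD A 1 q s) addnC op_powD.
(* For x = (A^q - i) s in dom A: <x, A w> = <A x, w> = <(A^q - i) A s, w> = <A s, y> = <s, z> = <x,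
   w'>. *)
have Aw : A w = w'.
  apply/eqP; rewrite -subr_eq0; apply/eqP; have [Adense _ _] := hypA.
  apply: (dense_orthogonal ip_norm Adense) => x Dx.
  have [s Ds sx] := op_pow_resolvent ip_norm linA q_gt0 saQ (j := 1)
    (conjCi _) (neq0Ci _) (conj I Dx).
  have [D1s DAs Acomm] := Dq1 _ Ds.
  have Dqs : dom (op_pow A q) s by apply: dom_op_pow_le Ds.
  have Ax : A x = op_pow A q (A s) - 'i *: A s.
    rewrite -sx opB//; last by apply: domZ => //; exact: D1.
    by rewrite opZ ?Acomm//; exact: D1.
  rewrite linearBr/= -symA//; last exact: D1.
  by rewrite Ax yw// yz ?zw'//; [rewrite -sx zw'// subrr|exact: D1].
have Dw1 : dom (op_pow A (1 + q)) w.
  rewrite addnC; apply/dom_op_powD; split; first by split=> //; exact: D1.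
  by rewrite /= Aw.
have [D1w _ _] := Dq1 _ Dw1.
by rewrite -wy addrC; apply: domP => //; exact: D1.
Qed.

End Hyponormal.

Theorem theorem2p20 (R : realType) (H : completeNormedModType R[i])
    (ip : {dot H for Num.conj}) (ip_norm : induces_norm ip)
    (A : operator H) (A_linear : linear_operator A)
    (A_hyponormal : hyponormal ip A)
    (p q : nat) (p_gt0 : (0 < p)%N) (q_gt0 : (0 < q)%N)
    (pq_coprime : coprime p q)
    (Ap_self_adjoint : self_adjoint ip (op_pow A p))
    (Aq_self_adjoint : self_adjoint ip (op_pow A q)) :
  self_adjoint ip A.
Proof.
have [m n mn _] := egcdnP q p_gt0.
rewrite (eqP pq_coprime) addn1 in mn.
have AE x : dom A x -> adjoint ip A x = A x.
  exact: (coprime_powers_adjoint_eq ip_norm A_linear A_hyponormal q_gt0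
            Ap_self_adjoint Aq_self_adjoint mn).
have symA : symmetric_on ip A.
  by move=> x y Dx Dy; rewrite -(AE y Dy) hyponormal_adjoint_value.
have [Adense Asub _] := A_hyponormal.
split=> //; split=> [|x /AE//]; apply/seteqP; split=> //.
exact: (dom_adjoint_sub ip_norm A_linear A_hyponormal q_gt0
  Aq_self_adjoint symA).
Qed.
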